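(* Let $G$ be a precompact abelian group. Then the dual group $G_p^\wedge$ contains nontrivial convergent sequences if and only if there is a continuous homomorphism of $G$ onto a separating subgroup of $c_0(\mathbb{T})$.
   Context: A topological group is precompact if it is topologically isomorphic to a dense subgroup of a compact (Hausdorff) topological group. $\mathbb{T}$ is the circle group $\{z\in\mathbb{C}:|z|=1\}$ with its usual compact topology. $G_p^\wedge$ denotes the group of all continuous homomorphisms $G\to\mathbb{T}$ under pointwise multiplication, endowed with the topology of pointwise convergence on elements of $G$. A convergent sequence is nontrivial if it is not eventually constant. $c_0(\mathbb{T})$ is the group of all sequences in $\mathbb{T}$ converging to $1$, viewed as a subgroup of the compact group $\mathbb{T}^{\mathbb{N}}$ and equipped with the subspace topology. For a compact Hausdorff space $K$, $C_p(K,\mathbb{T})$ is the group of all continuous functions $K\to\mathbb{T}$ with the pointwise convergence topology, and a subgroup $S$ of $C_p(K,\mathbb{T})$ is separating if for any two distinct $x,y\in K$ there is $g\in S$ with $g(x)\neq g(y)$. Elements $(x_n)_{n\in\mathbb{N}}$ of $c_0(\mathbb{T})$ are regarded as continuous functions on $K=\{1/n:n\in\mathbb{N}\}\cup\{0\}$ by $1/n\mapsto x_n$ and $0\mapsto 1$, and a subgroup of $c_0(\mathbb{T})$ is separating if it separates the points of $K$ in this sense, i.e. for all $n\ne m$ it contains a sequence $x$ with $x_n\neq x_m$, and for every $n$ it contains a sequence $x$ with $x_n\neq 1$. *)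

(* Defs.v *)
From HB Require Import structures.
From mathcomp Require Import all_boot all_order all_algebra.
From mathcomp Require Import all_classical all_reals all_analysis.
From mathcomp Require Import complex.

Set Implicit Arguments.
Unset Strict Implicit.
Unset Printing Implicit Defensive.

Import Order.TTheory GRing.Theory Num.Theory.

Local Open Scope classical_set_scope.
Local Open Scope group_scope.

HB.mixin Record isTopologicalGroup G of Topological G & Group G := {
  mulg_continuous : continuous (fun x : G * G => x.1 * x.2);
  invg_continuous : continuous (fun x : G => x^-1)
}.

#[short(type="topologicalGroupType")]
HB.structure Definition TopologicalGroup :=
  {G of Topological G & Group G & isTopologicalGroup G}.

Definition homomorphism (G H : groupType) (f : G -> H) : Prop :=
  {morph f : x y / x * y}.

Record subgroup (G : groupType) := Subgroup {
  subgroup_set :> set G;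
  subgroup1 : subgroup_set 1;
  subgroupM : forall x y,
    subgroup_set x -> subgroup_set y -> subgroup_set (x * y);
  subgroupV : forall x, subgroup_set x -> subgroup_set x^-1
}.

(* The carrier is a named alias: the group structure needs the closure proofs
   stored in [S], which the underlying [set_type] does not record. *)
Definition subgroup_type (G : groupType) (S : subgroup G) : Type :=
  set_type (subgroup_set S).

Section subgroup_group.
Variables (G : groupType) (S : subgroup G).

HB.instance Definition _ := Choice.on (subgroup_type S).

Definition subgroup_val (x : subgroup_type S) : G := set_val x.

Definition subgroup_one : subgroup_type S :=
  exist _ 1 (mem_set (subgroup1 S)).

Definition subgroup_mul (x y : subgroup_type S) : subgroup_type S :=
  exist _ (set_val x * set_val y)
    (mem_set (subgroupM (set_valP x) (set_valP y))).

Definition subgroup_inv (x : subgroup_type S) : subgroup_type S :=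
  exist _ (set_val x)^-1 (mem_set (subgroupV (set_valP x))).

Lemma subgroup_val_inj : injective subgroup_val.
Proof. exact: val_inj. Qed.

Let mulA : associative subgroup_mul.
Proof. by move=> x y z; apply: subgroup_val_inj; exact: mulgA. Qed.

Let mul1 : left_id subgroup_one subgroup_mul.
Proof. by move=> x; apply: subgroup_val_inj; exact: mul1g. Qed.

Let mulr1 : right_id subgroup_one subgroup_mul.
Proof. by move=> x; apply: subgroup_val_inj; exact: mulg1. Qed.

Let mulV : left_inverse subgroup_one subgroup_inv subgroup_mul.
Proof. by move=> x; apply: subgroup_val_inj; exact: mulVg. Qed.

Let mulrV : right_inverse subgroup_one subgroup_inv subgroup_mul.
Proof. by move=> x; apply: subgroup_val_inj; exact: mulgV. Qed.

HB.instance Definition _ :=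
  isGroup.Build (subgroup_type S) mulA mul1 mulr1 mulV mulrV.

End subgroup_group.

Section subgroup_topology.
Variables (G : topologicalGroupType) (S : subgroup G).

HB.instance Definition _ :=
  Topological.copy (subgroup_type S) (set_type (subgroup_set S)).

Lemma subgroup_val_continuous : continuous (@subgroup_val G S).
Proof. exact: (@initial_continuous _ _ (@set_val G (subgroup_set S))). Qed.

Lemma subgroup_continuous (T : topologicalType) (f : T -> subgroup_type S) :
  continuous (@subgroup_val G S \o f) -> continuous f.
Proof.
move=> /continuousP cf; apply/continuousP => _ [B oB <-].
exact: cf.
Qed.

Let mul_cont :
  continuous (fun x : subgroup_type S * subgroup_type S => x.1 * x.2).
Proof.
apply: subgroup_continuous => x.
apply: (@continuous_comp _ _ _
  (fun x : subgroup_type S * subgroup_type S =>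
     (subgroup_val x.1, subgroup_val x.2)) (fun x : G * G => x.1 * x.2)).
  apply: cvg_pair; apply: continuous_comp.
  - exact: cvg_fst.
  - exact: subgroup_val_continuous.
  - exact: cvg_snd.
  - exact: subgroup_val_continuous.
exact: mulg_continuous.
Qed.

Let inv_cont : continuous (fun x : subgroup_type S => x^-1).
Proof.
apply: subgroup_continuous => x.
apply: (@continuous_comp _ _ _ (@subgroup_val G S) (fun x : G => x^-1)).
  exact: subgroup_val_continuous.
exact: invg_continuous.
Qed.

HB.instance Definition _ :=
  isTopologicalGroup.Build (subgroup_type S) mul_cont inv_cont.

End subgroup_topology.

Section power.
Variables (I : Type) (G : topologicalGroupType).
Local Notation P := {ptws I -> G}.

Let mulA : associative (fun x y : P => (fun i => x i * y i) : P).
Proof. by move=> x y z; apply/funext => i; exact: mulgA. Qed.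

Let mul1 : left_id ((fun=> 1) : P) (fun x y : P => (fun i => x i * y i) : P).
Proof. by move=> x; apply/funext => i; exact: mul1g. Qed.

Let mulr1 : right_id ((fun=> 1) : P) (fun x y : P => (fun i => x i * y i) : P).
Proof. by move=> x; apply/funext => i; exact: mulg1. Qed.

Let mulV : left_inverse ((fun=> 1) : P) (fun x : P => (fun i => (x i)^-1) : P)
  (fun x y : P => (fun i => x i * y i) : P).
Proof. by move=> x; apply/funext => i; exact: mulVg. Qed.

Let mulrV : right_inverse ((fun=> 1) : P)
  (fun x : P => (fun i => (x i)^-1) : P)
  (fun x y : P => (fun i => x i * y i) : P).
Proof. by move=> x; apply/funext => i; exact: mulgV. Qed.

HB.instance Definition _ := isGroup.Build P mulA mul1 mulr1 mulV mulrV.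

Lemma power_continuous (T : topologicalType) (f : T -> P) :
  (forall i, continuous (fun t => f t i)) -> continuous f.
Proof.
move=> cf t; apply/cvg_sup => i U [_ [[B oB <-] Bft] sBU].
have : nbhs t ((fun t => f t i) @^-1` B).
  by apply: (cf i t); apply: open_nbhs_nbhs.
by apply: filterS => u Bu; exact: sBU.
Qed.

Lemma power_proj_continuous i : continuous (fun x : P => x i).
Proof.
move=> x U xU; have /cvg_sup /(_ i) cx : nbhs x --> x by apply: cvg_id.
by apply: cx; exact: (@initial_continuous _ _ (fun f : P => f i) x U xU).
Qed.

Let mul_cont : continuous (fun x : P * P => x.1 * x.2).
Proof.
apply: power_continuous => i x.
apply: (@continuous_comp _ _ _ (fun x : P * P => (x.1 i, x.2 i))
  (fun x : G * G => x.1 * x.2)).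
  apply: cvg_pair.
    apply: (@continuous_comp _ _ _ fst (fun y : P => y i)).
      exact: cvg_fst.
    exact: power_proj_continuous.
  apply: (@continuous_comp _ _ _ snd (fun y : P => y i)).
    exact: cvg_snd.
  exact: power_proj_continuous.
exact: mulg_continuous.
Qed.

Let inv_cont : continuous (fun x : P => x^-1).
Proof.
apply: power_continuous => i x.
apply: (@continuous_comp _ _ _ (fun x : P => x i) (fun x : G => x^-1)).
  exact: power_proj_continuous.
exact: invg_continuous.
Qed.

HB.instance Definition _ := isTopologicalGroup.Build P mul_cont inv_cont.

End power.

Section circle.
Variable R : realType.

(* [R[i]^o] is the field of complex numbers with the topology of the modulus. *)
Definition circle : Type := set_type [set z : R[i]^o | `|z|%R = 1%R].

HB.instance Definition _ :=
  Topological.copy circle (set_type [set z : R[i]^o | `|z|%R = 1%R]).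

Definition circle_val (z : circle) : R[i]^o := set_val z.

Lemma circle_val_inj : injective circle_val.
Proof. exact: val_inj. Qed.

Lemma circle_norm (z : circle) : `|circle_val z|%R = 1%R.
Proof. exact: (set_valP z). Qed.

Lemma circle_neq0 (z : circle) : circle_val z != 0%R.
Proof. by rewrite -normr_eq0 circle_norm oner_eq0. Qed.

Definition circle_one : circle := exist _ (1%R : R[i]^o) (mem_set (normr1 _)).

Fact circle_mul_subproof (z w : circle) :
  `|circle_val z * circle_val w|%R = 1%R.
Proof. by rewrite normrM !circle_norm mulr1. Qed.

Definition circle_mul (z w : circle) : circle :=
  exist _ (circle_val z * circle_val w)%R (mem_set (circle_mul_subproof z w)).

Fact circle_inv_subproof (z : circle) : `|(circle_val z)^-1|%R = 1%R.
Proof. by rewrite normfV circle_norm invr1. Qed.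

Definition circle_inv (z : circle) : circle :=
  exist _ (circle_val z)^-1%R (mem_set (circle_inv_subproof z)).

Let mulA : associative circle_mul.
Proof. by move=> x y z; apply: circle_val_inj; exact: mulrA. Qed.

Let mul1 : left_id circle_one circle_mul.
Proof. by move=> x; apply: circle_val_inj; exact: mul1r. Qed.

Let mulr1 : right_id circle_one circle_mul.
Proof. by move=> x; apply: circle_val_inj; exact: mulr1. Qed.

Let mulV : left_inverse circle_one circle_inv circle_mul.
Proof. by move=> x; apply: circle_val_inj; apply: mulVf; exact: circle_neq0. Qed.

Let mulrV : right_inverse circle_one circle_inv circle_mul.
Proof. by move=> x; apply: circle_val_inj; apply: mulfV; exact: circle_neq0. Qed.

HB.instance Definition _ := isGroup.Build circle mulA mul1 mulr1 mulV mulrV.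

Lemma circle_mulC (z w : circle) : z * w = w * z.
Proof. by apply: circle_val_inj; exact: mulrC. Qed.

Lemma circle_val_continuous : continuous circle_val.
Proof. exact: initial_continuous. Qed.

Lemma circle_continuous (T : topologicalType) (f : T -> circle) :
  continuous (circle_val \o f) -> continuous f.
Proof.
move=> /continuousP cf; apply/continuousP => _ [B oB <-].
exact: cf.
Qed.

Let mul_cont : continuous (fun x : circle * circle => x.1 * x.2).
Proof.
apply: circle_continuous => x.
apply: (@cvgM R[i] _ _ _ (circle_val \o fst) (circle_val \o snd)).
  apply: (@continuous_comp _ _ _ fst circle_val); first exact: cvg_fst.
  exact: circle_val_continuous.
apply: (@continuous_comp _ _ _ snd circle_val); first exact: cvg_snd.
exact: circle_val_continuous.
Qed.

Let inv_cont : continuous (fun x : circle => x^-1).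
Proof.
apply: circle_continuous => x.
apply: (@cvgV R[i] _ _ _ circle_val (circle_val x)).
- exact: nbhs_filter.
- exact: circle_neq0.
- exact: circle_val_continuous.
Qed.

HB.instance Definition _ := isTopologicalGroup.Build circle mul_cont inv_cont.

End circle.

Definition topologically_isomorphic (G H : topologicalGroupType) : Prop :=
  exists (f : G -> H) (g : H -> G),
    [/\ homomorphism f, cancel f g, cancel g f, continuous f & continuous g].

(* This is the notion for topological groups; the library's [precompact]
   concerns subsets of a topological space with compact closure. *)
Definition precompact_group (G : topologicalGroupType) : Prop :=
  exists (K : topologicalGroupType) (S : subgroup K),
    [/\ hausdorff_space K, compact [set: K], dense S &
        topologically_isomorphic G (subgroup_type S)].

Section dual.
Variables (R : realType) (G : topologicalGroupType).

Definition characters : set {ptws G -> circle R} :=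
  [set f : G -> circle R | homomorphism f /\ continuous f].

Fact characters1 : characters 1.
Proof.
split; first by move=> x y; exact/esym/mulg1.
by move=> x; exact: cvg_cst.
Qed.

Fact charactersM (f g : {ptws G -> circle R}) :
  characters f -> characters g -> characters (f * g).
Proof.
move=> [fM cf] [gM cg]; split=> [x y|x].
  transitivity (f (x * y) * g (x * y)) => //; rewrite fM gM -!mulgA.
  by congr (_ * _); rewrite !mulgA (circle_mulC (f y)).
apply: (@continuous_comp _ _ _ (fun x => (f x, g x))
  (fun z : circle R * circle R => z.1 * z.2)); last exact: mulg_continuous.
exact: (cvg_pair (cf x) (cg x)).
Qed.

Fact charactersV (f : {ptws G -> circle R}) :
  characters f -> characters f^-1.
Proof.
move=> [fM cf]; split=> [x y|x].
  by transitivity (f (x * y))^-1 => //; rewrite fM invgM circle_mulC.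
apply: (@continuous_comp _ _ _ f (fun z : circle R => z^-1)); first exact: cf.
exact: invg_continuous.
Qed.

Definition dual_subgroup : subgroup {ptws G -> circle R} :=
  Subgroup characters1 charactersM charactersV.

Definition dual : topologicalGroupType := subgroup_type dual_subgroup.

End dual.

Definition nontrivial_convergent (T : topologicalType) (u : nat -> T) : Prop :=
  (exists l : T, u @ \oo --> l) /\
  ~ (exists c : T, \forall n \near \oo, u n = c).

Section c0.
Variable R : realType.

Definition null_sequences : set {ptws nat -> circle R} :=
  [set x : nat -> circle R | x @ \oo --> (1 : circle R)].

Fact null_sequences1 : null_sequences 1.
Proof. exact: cvg_cst. Qed.

Fact null_sequencesM (x y : {ptws nat -> circle R}) :
  null_sequences x -> null_sequences y -> null_sequences (x * y).
Proof.
move=> x1 y1.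
have := @mulg_continuous (circle R) (1, 1); rewrite /continuous_at /= mulg1.
apply: (@cvg_comp _ _ _ (fun n => (x n, y n))
  (fun z : circle R * circle R => z.1 * z.2) _ (nbhs ((1, 1) : _ * circle R))).
exact: (cvg_pair x1 y1).
Qed.

Fact null_sequencesV (x : {ptws nat -> circle R}) :
  null_sequences x -> null_sequences x^-1.
Proof.
move=> x1.
have := @invg_continuous (circle R) 1; rewrite /continuous_at invg1.
exact: (@cvg_comp _ _ _ x (fun z : circle R => z^-1) _ _ _ x1).
Qed.

Definition c0_subgroup : subgroup {ptws nat -> circle R} :=
  Subgroup null_sequences1 null_sequencesM null_sequencesV.

Definition c0 : topologicalGroupType := subgroup_type c0_subgroup.

Definition c0_seq (x : c0) : nat -> circle R := subgroup_val x.

(* Separation of the points of {1/n : n >= 1} U {0} by the functions sending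
   1/n to the n-th term and 0 to 1; the term of index n is the value at
   1/(n+1). *)
Definition separating (S : set c0) : Prop :=
  (forall n m : nat, n <> m -> exists2 x : c0, S x & c0_seq x n <> c0_seq x m)
  /\ (forall n : nat, exists2 x : c0, S x & c0_seq x n <> 1).

End c0.

(* Main.v *)
Require Import Defs.
From mathcomp Require Import all_boot all_order all_algebra.
From mathcomp Require Import all_classical all_reals all_analysis.
From mathcomp Require Import complex.

(** The proof transposes a family of numbers [chi_n(g)], indexed by [n : nat]
    and [g : G]: for fixed [n] it is a character of [G], for fixed [g] it is a
    sequence in the circle. Convergence in the dual is pointwise
    ([cvg_dualP]), so the characters [chi_n] converge to 1 exactly when every
    sequence [n |-> chi_n(g)] is in [c0]; and continuity into [c0] is
    coordinatewise, so the map sending [g] to that sequence is a continuous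
    homomorphism exactly when every [chi_n] is a character. Under this
    transposition, the image of [G] in [c0] is separating if and only if the
    characters [chi_n] are pairwise distinct and different from 1.

    From a homomorphism onto a separating subgroup one thus reads off an
    injective sequence of characters converging to 1, which cannot be
    eventually constant.

    Conversely, given a nontrivial convergent sequence [u] in the dual with
    limit [l], it remains to make its terms distinct. As the dual is a
    Hausdorff space ([dual_hausdorff]), each value other than [l] is taken
    only finitely often, whereas values other than [l] occur infinitely often;
    hence [u] has an injective subsequence avoiding [l]
    ([injective_subsequence]). Multiplying it by the inverse of [l] gives
    distinct nontrivial characters converging to 1
    ([null_subsequence_injective]), whose transpose is onto its range. *)

Set Implicit Arguments.
Unset Strict Implicit.
Unset Printing Implicit Defensive.

Local Open Scope classical_set_scope.
Local Open Scope group_scope.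

(** * Injective subsequences of convergent sequences *)

(** A value other than the limit is eventually avoided for good, so beyond any
    rank [N] there is a term that differs from the limit and from the first [N]
    terms; such terms are picked one after the other. *)
Lemma injective_subsequence (T : topologicalType) (u : nat -> T) (l : T) :
  accessible_space T -> u @ \oo --> l ->
  ~ (exists c : T, \forall n \near \oo, u n = c) ->
  exists phi : nat -> nat,
    [/\ {homo phi : m n / (m < n)%N}, injective (u \o phi) &
        forall n, u (phi n) <> l].
Proof.
move=> T1 ul unc.
have avoid x : x <> l -> \forall k \near \oo, u k <> x.
  move=> /eqP; rewrite eq_sym => /T1[A [oA /set_mem Al /set_mem Ax]].
  have : \forall k \near \oo, A (u k) by apply: ul; exact: open_nbhs_nbhs.
  by apply: filterS => k Auk ukx; apply: Ax; rewrite -ukx.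
have avoid_all N : \forall k \near \oo,
    forall i, (i < N)%N -> u i <> l -> u k <> u i.
  elim: N => [|N IH]; first by apply: nearW.
  have [uNl|/avoid uN] := pselect (u N = l).
    apply: filterS IH => k ukP i; rewrite ltnS leq_eqVlt => /predU1P[->//|].
    exact: ukP.
  apply: filterS2 IH uN => k ukP ukN i.
  by rewrite ltnS leq_eqVlt => /predU1P[->//|]; exact: ukP.
have fresh N : exists m, [/\ (N <= m)%N, u m <> l &
    forall i, (i < N)%N -> u m <> u i].
  apply: contrapT => nofresh; apply: unc; exists l.
  apply: filterS2 (avoid_all N) (nbhs_infty_ge N) => m ukP Nm.
  apply: contrapT => uml; apply: nofresh; exists m; split=> // i iN umi.
  by apply: (ukP i) => //; rewrite -umi.
have [f fP] := choice fresh.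
(* Starting each search just after the previous index makes [phi] increasing
   and each new term different from all the earlier ones. *)
pose phi := fix phi n := if n is n'.+1 then f (phi n').+1 else f 0%N.
have phiS n : (phi n < phi n.+1)%N by have [] := fP (phi n).+1.
have phi_lt : {homo phi : m n / (m < n)%N}.
  by apply: homo_ltn => //; exact: ltn_trans.
have uphi_neq m n : (m < n)%N -> u (phi n) <> u (phi m).
  case: n => // n mn; have [_ _ uf] := fP (phi n).+1; apply: uf.
  move: mn; rewrite !ltnS leq_eqVlt => /predU1P[->//|/phi_lt]; exact: ltnW.
exists phi; split=> // [m n /= umn|n].
  by case: (ltngtP m n) => // /uphi_neq; rewrite umn.
by case: n => [|n] /=; [have [] := fP 0%N|have [] := fP (phi n).+1].
Qed.

Lemma cvg_increasing_subsequence (T : topologicalType) (u : nat -> T) (l : T)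
    (phi : nat -> nat) :
  {homo phi : m n / (m < n)%N} -> u @ \oo --> l -> (u \o phi) @ \oo --> l.
Proof.
move=> phi_lt ul; apply: (cvg_comp _ _ _ ul) => A [N _ NA].
exists N => // n /= Nn.
apply: NA => /=; apply: (leq_trans Nn).
by elim: n {Nn} => // n IH; apply: (leq_ltn_trans IH); exact: phi_lt.
Qed.

Lemma injective_not_eventually_constant (T : Type) (u : nat -> T) :
  injective u -> ~ (exists c : T, \forall n \near \oo, u n = c).
Proof.
move=> uI [c [N _ Nc]].
have /uI /eqP : u N = u N.+1 by rewrite (Nc N) ?(Nc N.+1) //=.
by rewrite ltn_eqF.
Qed.

(** * Topology of subgroups and of powers *)

Lemma hausdorff_separated_by_continuous (T Y : topologicalType) :
  hausdorff_space Y ->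
  (forall x y : T, x <> y -> exists2 f : T -> Y, continuous f & f x <> f y) ->
  hausdorff_space T.
Proof.
move=> hY sep x y clxy; apply: contrapT => /sep[f cf]; apply.
apply: hY => A B fA fB.
have [z [Az Bz]] := clxy _ _ (cf x A fA) (cf y B fB).
by exists (f z).
Qed.

Lemma circle_hausdorff (R : realType) : hausdorff_space (circle R).
Proof.
apply: (@hausdorff_separated_by_continuous _ (R[i]^o)).
  exact: norm_hausdorff.
move=> x y xy; exists (@circle_val R); first exact: circle_val_continuous.
by move=> /circle_val_inj.
Qed.

Lemma cvg_subgroup (G : topologicalGroupType) (S : subgroup G)
    (u : nat -> subgroup_type S) (l : subgroup_type S) :
  (@subgroup_val G S \o u) @ \oo --> subgroup_val l -> u @ \oo --> l.
Proof.
move=> ul U [_ [[B oB <-] Bl] sBU].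
have : \forall n \near \oo, B (subgroup_val (u n)).
  by apply: ul; apply: open_nbhs_nbhs.
by apply: filterS => n Bn; exact: sBU.
Qed.

Lemma cvg_power (I : Type) (G : topologicalGroupType)
    (u : nat -> {ptws I -> G}) (l : {ptws I -> G}) :
  (forall i, (u n i @[n --> \oo]) --> l i) -> u @ \oo --> l.
Proof.
move=> ul; apply/cvg_sup => i U [_ [[B oB <-] Bl] sBU].
have : \forall n \near \oo, B (u n i).
  by apply: (ul i); apply: open_nbhs_nbhs.
by apply: filterS => n Bn; exact: sBU.
Qed.

Lemma subgroup_val_morph (G : groupType) (S : subgroup G) :
  homomorphism (@subgroup_val G S).
Proof. by []. Qed.

Lemma subgroup_coord_continuous (I : Type) (G : topologicalGroupType)
    (S : subgroup {ptws I -> G}) (i : I) :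
  continuous (fun x : subgroup_type S => (subgroup_val x : I -> G) i).
Proof.
move=> x.
apply: (@continuous_comp _ _ _ (@subgroup_val _ S)
  (fun y : {ptws I -> G} => y i)).
  exact: subgroup_val_continuous.
exact: power_proj_continuous.
Qed.

Lemma mulgr_continuous (G : topologicalGroupType) (a : G) :
  continuous (fun x : G => x * a).
Proof.
move=> x.
apply: (@continuous_comp _ _ _ (fun y => (y, a)) (fun z : G * G => z.1 * z.2)).
  by apply: cvg_pair; [exact: cvg_id|exact: cvg_cst].
exact: mulg_continuous.
Qed.

(** * Characters and their pointwise convergence *)

Section dual_evaluation.
Variables (R : realType) (G : topologicalGroupType).

Definition dual_eval (chi : dual R G) (g : G) : circle R := subgroup_val chi g.

Lemma dual_eval_inj (chi psi : dual R G) :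
  (forall g, dual_eval chi g = dual_eval psi g) -> chi = psi.
Proof. by move=> e; apply: subgroup_val_inj; apply/funext. Qed.

Lemma dual_eval_morph (chi : dual R G) : homomorphism (dual_eval chi).
Proof. by have [] := set_valP chi. Qed.

Lemma dual_eval_continuous (chi : dual R G) : continuous (dual_eval chi).
Proof. by have [] := set_valP chi. Qed.

Lemma dual_eval_continuousl g :
  continuous (fun chi : dual R G => dual_eval chi g).
Proof. exact: (@subgroup_coord_continuous G (circle R)). Qed.

Lemma dual_neqP (chi psi : dual R G) :
  chi <> psi -> exists g, dual_eval chi g <> dual_eval psi g.
Proof.
move=> ne; apply/existsNP => e; apply: ne; exact: dual_eval_inj.
Qed.

Lemma dual_hausdorff : hausdorff_space (dual R G).
Proof.
apply: (hausdorff_separated_by_continuous (@circle_hausdorff R)).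
move=> chi psi /dual_neqP[g ne].
by exists (dual_eval^~ g); first exact: dual_eval_continuousl.
Qed.

(** This equivalence lets a null sequence of characters be read as a family of
    null sequences in the circle, one for each point of [G]. *)
Lemma cvg_dualP (u : nat -> dual R G) (l : dual R G) :
  u @ \oo --> l <->
  forall g, (dual_eval (u n) g @[n --> \oo]) --> dual_eval l g.
Proof.
split=> [ul g|ul].
  exact: (cvg_comp _ _ ul (@dual_eval_continuousl g l)).
by apply: cvg_subgroup; exact: cvg_power.
Qed.

Definition character_of (f : G -> circle R) (fM : homomorphism f)
  (cf : continuous f) : dual R G := exist _ f (mem_set (conj fM cf)).

End dual_evaluation.

(** * From sequences of characters to homomorphisms into c0, and back *)

Section onto_image.
Variables (G H : groupType) (h : G -> H) (hM : homomorphism h).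

Let h1 : h 1 = 1.
Proof. by apply: (@mulgI _ (h 1)); rewrite -hM !mulg1. Qed.

Fact range1 : range h 1. Proof. by exists 1. Qed.

Fact rangeM x y : range h x -> range h y -> range h (x * y).
Proof. by move=> [a _ <-] [b _ <-]; exists (a * b) => //; rewrite hM. Qed.

Fact rangeV x : range h x -> range h x^-1.
Proof.
move=> [a _ <-]; exists a^-1 => //.
by apply: (@mulIg _ (h a)); rewrite -hM !mulVg.
Qed.

Definition image_subgroup : subgroup H := Subgroup range1 rangeM rangeV.

Definition corestriction (g : G) : subgroup_type image_subgroup :=
  exist _ (h g) (mem_set (imageT h g)).

Lemma corestriction_morph : homomorphism corestriction.
Proof. by move=> x y; apply: subgroup_val_inj; exact: hM. Qed.

Lemma corestriction_surj : range corestriction = [set: _].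
Proof.
apply/seteqP; split=> // y _; have [g _ gy] := set_valP y.
by exists g => //; apply: subgroup_val_inj.
Qed.

End onto_image.

Section evaluation_into_c0.
Variables (R : realType) (G : topologicalGroupType) (w : nat -> dual R G).
Hypothesis w1 : w @ \oo --> (1 : dual R G).

Fact null_sequences_dual_eval g :
  null_sequences ((fun n => dual_eval (w n) g) : {ptws nat -> circle R}).
Proof. exact: ((cvg_dualP w 1).1 w1 g). Qed.

(** The transpose of the sequence of characters [w]. *)
Definition c0_eval (g : G) : c0 R :=
  exist _ (fun n => dual_eval (w n) g) (mem_set (null_sequences_dual_eval g)).

Lemma c0_eval_morph : homomorphism c0_eval.
Proof.
move=> x y; apply: subgroup_val_inj; apply/funext => n; exact: dual_eval_morph.
Qed.

Lemma c0_eval_continuous : continuous c0_eval.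
Proof.
by apply: subgroup_continuous; apply: power_continuous => n;
  exact: dual_eval_continuous.
Qed.

Lemma separating_range_c0_eval :
  injective w -> (forall n, w n <> 1) -> separating (range c0_eval).
Proof.
move=> wI wn1; split=> [n m nm|n].
  have [g ne] : exists g, dual_eval (w n) g <> dual_eval (w m) g.
    by apply: dual_neqP => /wI.
  by exists (c0_eval g).
have [g ne] := dual_neqP (wn1 n).
by exists (c0_eval g).
Qed.

End evaluation_into_c0.

Lemma c0_seq_morph (R : realType) n :
  homomorphism (fun x : c0 R => c0_seq x n).
Proof. by move=> x y; rewrite /c0_seq subgroup_val_morph. Qed.

Lemma c0_seq_continuous (R : realType) n :
  continuous (fun x : c0 R => c0_seq x n).
Proof. exact: (@subgroup_coord_continuous nat (circle R)). Qed.

(** This is where nontriviality of the convergent sequence is used: it turns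
    into the distinctness of the characters, which is what separation asks of
    their transpose. *)
Lemma null_subsequence_injective (R : realType) (G : topologicalGroupType)
    (u : nat -> dual R G) : nontrivial_convergent u ->
  exists w : nat -> dual R G,
    [/\ w @ \oo --> (1 : dual R G), injective w & forall n, w n <> 1].
Proof.
move=> [[l ul] unc].
have [phi [phi_lt uphiI uphil]] :=
  injective_subsequence (hausdorff_accessible (@dual_hausdorff R G)) ul unc.
exists (fun n => u (phi n) * l^-1); split=> [|m n|n].
- rewrite -[X in _ --> X](mulgV l).
  exact: (cvg_comp _ _ (cvg_increasing_subsequence phi_lt ul)
    (@mulgr_continuous (dual R G) l^-1 l)).
- by move=> /mulIg; exact: uphiI.
- by move=> e; apply: (uphil n); apply: (@mulIg _ l^-1); rewrite mulgV.
Qed.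

Theorem theorem3p6 (R : realType) (G : topologicalGroupType)
    (abelianG : forall x y : G, x * y = y * x)
    (precompactG : precompact_group G) :
  (exists u : nat -> dual R G, nontrivial_convergent u) <->
  (exists (S : subgroup (c0 R)) (h : G -> subgroup_type S),
     [/\ separating S, homomorphism h, continuous h &
         range h = [set: subgroup_type S]]).
Proof.
split=> [[u /null_subsequence_injective[w [w1 wI wn1]]]|].
  exists (image_subgroup (c0_eval_morph w1)),
    (corestriction (c0_eval_morph w1)); split.
  - exact: separating_range_c0_eval.
  - exact: corestriction_morph.
  - by apply: subgroup_continuous; exact: c0_eval_continuous.
  - exact: corestriction_surj.
move=> [S [h [[sep _] hM ch hS]]].
pose coord n g := c0_seq (subgroup_val (h g)) n.
have coordM n : homomorphism (coord n).
  by move=> x y; rewrite /coord hM subgroup_val_morph c0_seq_morph.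
have coord_continuous n : continuous (coord n).
  move=> g; apply: (@continuous_comp _ _ _ (@subgroup_val _ S \o h)
    (fun x : c0 R => c0_seq x n)); last exact: c0_seq_continuous.
  apply: continuous_comp; first exact: ch.
  exact: subgroup_val_continuous.
pose u n := character_of (@coordM n) (@coord_continuous n).
exists u; split.
  exists 1; apply/cvg_dualP => g; exact: (set_valP (subgroup_val (h g))).
apply: injective_not_eventually_constant => n m unm.
apply: contrapT => /(sep n m)[x Sx]; apply.
have [g _ hg] : range h (exist _ x (mem_set Sx)) by rewrite hS.
have -> : x = subgroup_val (h g) by rewrite hg.
exact: (congr1 (fun chi => dual_eval chi g) unm).
Qed.
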